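(* Let $K$ be an algebraically closed field with $\operatorname{char}(K)\neq 2$. Up to isomorphism there exist exactly $4$ nilpotent Jordan algebras of dimension $3$ over $K$: every such algebra is isomorphic to one of the following pairwise non-isomorphic nilpotent Jordan algebras, each with basis $a,b,c$. With central component: - $J_{3,1}$: all products are zero; - $J_{3,2}$: $a^2=b$. Without central component: - $J_{3,3}$: $a^2=c,\ b^2=c$; - $J_{3,4}$: $a^2=b,\ a\circ b=c$.
   Context: A Jordan algebra over a field $K$ is a $K$-vector space $J$ with a symmetric bilinear product $\circ:J\times J\to J$ satisfying $x^2\circ(x\circ y)=x\circ(x^2\circ y)$ for all $x,y\in J$, where $x^2=x\circ x$. Set $c^1(J)=J$ and $c^m(J)=c^{m-1}(J)\circ J$ (the span of the products) for $m\geq 2$; $J$ is nilpotent if $c^n(J)=0$ for some $n$. The centre is $Z(J)=\{x\in J: x\circ y=0\ \forall y\in J\}$. $J$ has a central component if $J=I_1\oplus I_2$ is a direct sum of two ideals with $I_2$ nonzero and contained in $Z(J)$. In the multiplication tables, products of basis vectors that are not listed (and do not follow from commutativity) are zero. *)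

(* Defs.v *)
From HB Require Import structures.
From mathcomp Require Import all_boot all_order all_algebra.

Set Implicit Arguments.
Unset Strict Implicit.
Unset Printing Implicit Defensive.

Import GRing.Theory.
Local Open Scope ring_scope.

Section Algebra.

Variables (K : fieldType) (J : vectType K) (mul : {bilinear J -> J -> J}).
Local Notation "x ** y" := (mul x y) (at level 40).
Implicit Types (U V W : {vspace J}) (x y : J).

Definition jordan_algebra : Prop :=
  commutative mul /\
  forall x y, (x ** x) ** (x ** y) = x ** ((x ** x) ** y).

(* As for prodv in falgebra, bases suffice to generate the span of all the
   products; see prodspaceP. *)
Definition prodspace U V : {vspace J} :=
  <<[seq u ** v | u <- vbasis U, v <- vbasis V]>>%VS.

Lemma prodspaceP U V W :
  reflect {in U & V, forall u v, u ** v \in W} (prodspace U V <= W)%VS.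
Proof.
apply: (iffP span_subvP) => [sW u v Uu Vv | sW _ /allpairsP[[u v] /= [Uu Vv ->]]].
  rewrite (coord_vbasis Uu) (coord_vbasis Vv) linear_sumlz; apply: memv_suml => i _.
  rewrite linear_sumr; apply: memv_suml => j _.
  rewrite linearZl_LR linearZr_LR !memvZ //.
  by apply: sW; apply/allpairsP; exists ((vbasis U)`_i, (vbasis V)`_j);
    rewrite !memt_nth.
by rewrite sW ?vbasis_mem.
Qed.

(* lower_central m is c^m(J) for m >= 1 (and lower_central 0 = c^1(J)). *)
Definition lower_central (m : nat) : {vspace J} :=
  iter m.-1 (fun U => prodspace U fullv) fullv.

Definition nilpotent_algebra : Prop :=
  exists2 n : nat, (0 < n)%N & lower_central n = 0%VS.

Definition in_centre x : Prop := forall y, x ** y = 0.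

Definition is_ideal U : Prop :=
  forall x y, x \in U -> x ** y \in U /\ y ** x \in U.

Definition has_central_component : Prop :=
  exists I1 I2 : {vspace J},
    [/\ is_ideal I1, is_ideal I2,
        (I1 + I2)%VS = fullv & (I1 :&: I2)%VS = 0%VS] /\
    (I2 <> 0%VS /\ forall x, x \in I2 -> in_centre x).

End Algebra.

Definition isomorphic_algebras (K : fieldType) (J J' : vectType K)
    (mul : {bilinear J -> J -> J}) (mul' : {bilinear J' -> J' -> J'}) : Prop :=
  exists2 f : {linear J -> J'}, bijective f &
    forall x y, f (mul x y) = mul' (f x) (f y).

(* The product on K^n for which the i-th and j-th vectors of the canonical
   basis have product t i j. *)
Definition table_mul (K : fieldType) (n : nat) (t : 'I_n -> 'I_n -> 'rV[K]_n)
    (x y : 'rV[K]_n) : 'rV[K]_n :=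
  \sum_i \sum_j (x 0 i * y 0 j) *: t i j.

Lemma table_mul_delta (K : fieldType) n (t : 'I_n -> 'I_n -> 'rV[K]_n) i j :
  table_mul t (delta_mx 0 i) (delta_mx 0 j) = t i j.
Proof.
rewrite /table_mul (bigD1 i) //= (bigD1 j) //= !mxE !eqxx mul1r scale1r.
rewrite !big1 ?addr0 // => [k nk|k nk]; last first.
  by rewrite !mxE !eqxx /= (negPf nk) mulr0 scale0r.
by apply: big1 => l _; rewrite !mxE !eqxx /= (negPf nk) mul0r scale0r.
Qed.

Lemma table_mul_is_bilinear (K : fieldType) n (t : 'I_n -> 'I_n -> 'rV[K]_n) :
  bilinear_for *:%R *:%R (table_mul t).
Proof.
split=> [y a x x' | x a y y']; rewrite /table_mul /= scaler_sumr -big_split /=;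
  apply: eq_bigr => i _; rewrite scaler_sumr -big_split /=;
  apply: eq_bigr => j _; rewrite !mxE scalerA -scalerDl.
  by rewrite mulrDl mulrA.
by rewrite mulrDr mulrCA.
Qed.

HB.instance Definition _ (K : fieldType) n (t : 'I_n -> 'I_n -> 'rV[K]_n) :=
  bilinear_isBilinear.Build K 'rV[K]_n 'rV[K]_n 'rV[K]_n *:%R *:%R
    (table_mul t) (table_mul_is_bilinear t).

Section Tables.

Variable K : fieldType.
Local Notation algebra3 := {bilinear 'rV[K]_3 -> 'rV[K]_3 -> 'rV[K]_3}.

(* The basis a, b, c consists of the canonical vectors 0, 1, 2 of K^3. *)
Local Notation b := (delta_mx 0 1 : 'rV[K]_3).
Local Notation c := (delta_mx 0 2%:R : 'rV[K]_3).

Definition J31 : algebra3 := table_mul (fun _ _ => 0).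

Definition J32 : algebra3 := table_mul (fun i j =>
  match val i, val j with
  | 0%N, 0%N => b
  | _, _ => 0
  end).

Definition J33 : algebra3 := table_mul (fun i j =>
  match val i, val j with
  | 0%N, 0%N | 1%N, 1%N => c
  | _, _ => 0
  end).

Definition J34 : algebra3 := table_mul (fun i j =>
  match val i, val j with
  | 0%N, 0%N => b
  | 0%N, 1%N | 1%N, 0%N => c
  | _, _ => 0
  end).

(* J3 k is the algebra J_{3,k+1}. *)
Definition J3 (k : 'I_4) : algebra3 := tnth [tuple J31; J32; J33; J34] k.

End Tables.

(* Main.v *)
From HB Require Import structures.
Require Import Defs.
From mathcomp Require Import all_boot all_order all_algebra.
From mathcomp Require Import ring.
Import GRing.Theory.
Local Open Scope ring_scope.

Set Implicit Arguments.
Unset Strict Implicit.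
Unset Printing Implicit Defensive.

(* The lower central series of a nilpotent algebra J decreases strictly, so if
   dim J = 3 then dim c^2(J) <= 2. If c^2(J) has dimension 2, then c^4(J) = 0
   and any a outside c^2(J) satisfies J = <a> + c^2(J) and
   c^2(J) = <a^2> + c^3(J); as a^2 o a^2 = a o (a^2 o a) = 0 by the Jordan
   identity, this forces a^2 o a <> 0, and a, a^2, a^2 o a is a basis with the
   table of J_{3,4}. Otherwise c^3(J) = 0; if c^2(J) <> 0, polarization (where
   char K <> 2 matters) gives c^2(J) = <a^2> with a^2 <> 0, and some b outside
   <a^2> satisfies a o b = 0. Depending on whether b^2 vanishes this is J_{3,2}
   or, after rescaling b by a square root, J_{3,3}.
   The four algebras are told apart by whether all products vanish, whether
   (x o y) o z vanishes identically, and whether every central element is a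
   product; the last property also excludes central components, because when
   J = I_1 + I_2 with I_2 central, all products lie in I_1. *)

Lemma sum_ord3 (V : nmodType) (F : 'I_3 -> V) :
  \sum_i F i = F 0 + F 1 + F 2%:R.
Proof.
rewrite !big_ord_recl big_ord0 addr0 addrA.
by congr (F _ + F _ + F _); apply/val_inj.
Qed.

Lemma forall_ord3 (P : 'I_3 -> Prop) : P 0 -> P 1 -> P 2%:R -> forall i, P i.
Proof.
by move=> P0 P1 P2 [[|[|[|//]]] i_lt]; [move: P0 | move: P1 | move: P2];
  congr P; apply/val_inj.
Qed.

(** * The four multiplication tables in coordinates *)

Section Tables.
Variable K : fieldType.
Implicit Types x y : 'rV[K]_3.
Local Notation a := (delta_mx 0 0 : 'rV[K]_3).
Local Notation b := (delta_mx 0 1 : 'rV[K]_3).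
Local Notation c := (delta_mx 0 2%:R : 'rV[K]_3).

Lemma J31E x y : J31 K x y = 0.
Proof. by rewrite /J31 /= /table_mul !sum_ord3 /= !scaler0 !addr0. Qed.

Lemma J32E x y : J32 K x y = (x 0 0 * y 0 0) *: b.
Proof. by rewrite /J32 /= /table_mul !sum_ord3 /= !scaler0 !addr0. Qed.

Lemma J33E x y : J33 K x y = (x 0 0 * y 0 0 + x 0 1 * y 0 1) *: c.
Proof.
by rewrite /J33 /= /table_mul !sum_ord3 /= !scaler0 !(addr0, add0r) scalerDl.
Qed.

Lemma J34E x y :
  J34 K x y = (x 0 0 * y 0 0) *: b + (x 0 0 * y 0 1 + x 0 1 * y 0 0) *: c.
Proof.
rewrite /J34 /= /table_mul !sum_ord3 /= !scaler0 !(addr0, add0r) scalerDl.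
by rewrite addrA.
Qed.

Definition tableE := (J31E, J32E, J33E, J34E).

(** The index enters [P] as a natural number, so that claims such as [k < 3] compute in each of the
    four cases. *)
Lemma J3_ind (P : nat -> {bilinear 'rV[K]_3 -> 'rV[K]_3 -> 'rV[K]_3} -> Prop) :
  P 0%N (J31 K) -> P 1%N (J32 K) -> P 2%N (J33 K) -> P 3%N (J34 K) ->
  forall k : 'I_4, P k (J3 K k).
Proof. by move=> P1 P2 P3 P4 [[|[|[|[|]]]] ?]. Qed.

Lemma J3_jordan k : jordan_algebra (J3 K k).
Proof.
apply: (J3_ind (P := fun _ A => jordan_algebra A));
  split=> x y; rewrite !tableE ?mxE ?eqxx //=.
- by rewrite mulrC.
- by congr (_ *: _); ring.
- by congr (_ *: _); ring.
- by congr (_ *: _); ring.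
- by congr (_ *: _ + _ *: _); ring.
- by congr (_ *: _ + _ *: _); ring.
Qed.

Lemma J3_mul4 k x y z t : J3 K k (J3 K k (J3 K k x y) z) t = 0.
Proof.
apply: (J3_ind (P := fun _ A => A (A (A x y) z) t = 0));
  by rewrite !tableE //= !mxE /= !(mulr0, mul0r, addr0, scale0r).
Qed.
End Tables.

(** * Isomorphism invariants and central components *)

Section Invariants.
Variable K : fieldType.

Lemma isomorphic_algebras_sym (J J' : vectType K)
    (mul : {bilinear J -> J -> J}) (mul' : {bilinear J' -> J' -> J'}) :
  isomorphic_algebras mul mul' -> isomorphic_algebras mul' mul.
Proof.
move=> [f [g fK gK] fM].
pose gL : {linear J' -> J} := HB.pack g
  (GRing.isLinear.Build K J' J *:%R g (can2_linear fK gK)).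
exists gL => [|x y]; first by exists f.
by apply: (can_inj fK); rewrite fM !gK.
Qed.

Definition zero_algebra (J : vectType K) (mul : {bilinear J -> J -> J}) :=
  forall x y, mul x y = 0.

Definition central_products (J : vectType K) (mul : {bilinear J -> J -> J}) :=
  forall z, in_centre mul z -> exists x y, z = mul x y.

Definition two_step (J : vectType K) (mul : {bilinear J -> J -> J}) :=
  forall x y z, mul (mul x y) z = 0.

(** One implication suffices: [isomorphic_algebras_sym] supplies the other. *)
Definition isomorphism_invariant
    (P : forall J : vectType K, {bilinear J -> J -> J} -> Prop) :=
  forall (J J' : vectType K) (mul : {bilinear J -> J -> J})
    (mul' : {bilinear J' -> J' -> J'}),
  isomorphic_algebras mul mul' -> P J mul -> P J' mul'.

Lemma zero_algebra_iso : isomorphism_invariant zero_algebra.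
Proof.
move=> J J' mul mul' [f [g fK gK] fM] mul0 x y.
by rewrite -(gK x) -(gK y) -fM mul0 linear0.
Qed.

Lemma central_products_iso : isomorphism_invariant central_products.
Proof.
move=> J J' mul mul' [f [g fK gK] fM] cP z zC.
have [|x [y gz]] := cP (g z).
  by move=> y; apply: (can_inj fK); rewrite fM gK zC linear0.
by exists (f x), (f y); rewrite -fM -gz gK.
Qed.

Lemma two_step_iso : isomorphism_invariant two_step.
Proof.
move=> J J' mul mul' [f [g fK gK] fM] mul0 x y z.
by rewrite -(gK x) -(gK y) -(gK z) -!fM mul0 linear0.
Qed.

Lemma no_central_component (J : vectType K) (mul : {bilinear J -> J -> J}) :
  central_products mul -> ~ has_central_component mul.
Proof.
move=> cP [I1 [I2 [[I1_ideal _ sumI capI] [I2_neq0 I2_central]]]].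
apply: I2_neq0; apply/eqP; rewrite -subv0 -capI subv_cap subvv andbT.
apply/subvP=> z I2z; have [x [y def_z]] := cP z (I2_central z I2z).
have /memv_addP[x1 x1I [x2 x2I def_x]] : x \in (I1 + I2)%VS.
  by rewrite sumI memvf.
have /memv_addP[y1 y1I [y2 y2I def_y]] : y \in (I1 + I2)%VS.
  by rewrite sumI memvf.
(* As [x2] is central, [z] equals [mul x1 y], which lies in the ideal [I1]. *)
rewrite def_z def_x linearDl /= (I2_central x2) // addr0.
by have [] := I1_ideal x1 (y1 + y2) x1I; rewrite def_y.
Qed.

End Invariants.

(** * The lower central series, and algebras given by a table on a basis *)

Section LowerCentral.
Variables (K : fieldType) (J : vectType K) (mul : {bilinear J -> J -> J}).
Local Notation "x ** y" := (mul x y) (at level 40).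
Local Notation c := (lower_central mul).
Implicit Types U V W : {vspace J}.

Lemma memv_prodspace U V x y :
  x \in U -> y \in V -> x ** y \in prodspace mul U V.
Proof. by move=> Ux Vy; apply: (prodspaceP mul U V _ (subvv _)). Qed.

Lemma prodspace_neq0 U V : prodspace mul U V != 0%VS ->
  exists x y, [/\ x \in U, y \in V & x ** y != 0].
Proof.
rewrite -subv0; case: span_subvP => // sub0 _.
have [/hasP[xy] | /hasPn all0] := boolP
  (has (predC1 0) [seq u ** v | u <- vbasis U, v <- vbasis V]).
  case/allpairsP=> -[x y] /= [Ux Vy ->] nz.
  by exists x, y; rewrite !vbasis_mem.
case: sub0 => u /all0 /=; rewrite negbK memv0 //.
Qed.

Lemma prodspaceS U U' V : (U <= U')%VS ->
  (prodspace mul U V <= prodspace mul U' V)%VS.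
Proof.
move=> /subvP sUU'; apply/prodspaceP=> u v /sUU' U'u Vv.
exact: memv_prodspace.
Qed.

(** The recursion starts at index 2, because [c 0] and [c 1] are both the whole space; hence the
    shifted indices below. *)
Lemma lower_centralS m : c m.+2 = prodspace mul (c m.+1) fullv.
Proof. by []. Qed.

Lemma lower_central_subS m : (c m.+2 <= c m.+1)%VS.
Proof.
elim: m => [|m IHm]; first exact: subvf.
by rewrite lower_centralS [X in (_ <= X)%VS]lower_centralS prodspaceS.
Qed.

Lemma lower_central_sub m n : (0 < m <= n)%N -> (c n <= c m)%VS.
Proof.
case: m => // m /= /subnKC <-; elim: (n - _)%N => [|k IHk].
  by rewrite addn0.
by rewrite addnS addSn; apply: subv_trans (lower_central_subS _) IHk.
Qed.

(** If two consecutive terms agreed, the series would be constant from there on and could never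
    reach zero. *)
Lemma lower_central_strict m : nilpotent_algebra mul ->
  c m.+1 != 0%VS -> (\dim (c m.+2) < \dim (c m.+1))%N.
Proof.
move=> [n n_gt0 cn0] cm_neq0.
rewrite (ltn_leqif (dimv_leqif_eq (lower_central_subS m))).
apply: contraNneq cm_neq0 => cm_eq.
have cm_stable k : c (k + m).+1 = c m.+1.
  elim: k => // k IHk; rewrite -[RHS]cm_eq [RHS]lower_centralS -IHk.
  by rewrite -lower_centralS.
rewrite -subv0 -cn0 -(cm_stable n) lower_central_sub //.
by rewrite n_gt0 ltnW // ltnS leq_addr.
Qed.

(** The passage from elements to spans uses kernels: the vectors killed by given right
    multiplications form a subspace, and by [prodspaceP] a subspace contains a product space once it
    contains the products. *)
Lemma mul4_nilpotent :
  (forall x y z t, ((x ** y) ** z) ** t = 0) -> nilpotent_algebra mul.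
Proof.
move=> mul4; exists 4%N => //; apply/eqP; rewrite -subv0.
have kerP (F : 'End(J)) x : (x \in lker F) = (F x == 0) by rewrite memv_ker.
pose R y := linfun (applyr mul y).
have RE x y : R y x = x ** y by rewrite lfunE.
apply/prodspaceP=> u t u_c3 _; rewrite memv0 -RE -kerP.
apply: subvP u_c3; apply/prodspaceP=> v z v_c2 _.
rewrite kerP RE -[v ** z]RE -!RE -comp_lfunE -kerP.
apply: subvP v_c2; apply/prodspaceP=> x y _ _.
by rewrite kerP comp_lfunE !RE mul4.
Qed.

(** The isomorphism is built from rows to [J], sending coordinates to the combination of [X];
    bilinearity then reduces multiplicativity to the basis products. *)
Lemma isomorphic_table n (t : 'I_n -> 'I_n -> 'rV[K]_n) (X : n.-tuple J) :
  basis_of fullv X ->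
  (forall i j : 'I_n, X`_i ** X`_j = \sum_k t i j 0 k *: X`_k) ->
  isomorphic_algebras mul (table_mul t).
Proof.
move=> X_basis XX; have X_free := basis_free X_basis.
pose comb (v : 'rV[K]_n) := \sum_i v 0 i *: X`_i.
have comb_linear : linear comb.
  move=> k u v; rewrite /comb scaler_sumr -big_split /=.
  by apply: eq_bigr => i _; rewrite !mxE scalerDl scalerA.
pose combL : {linear 'rV[K]_n -> J} := HB.pack comb
  (GRing.isLinear.Build K 'rV[K]_n J *:%R comb comb_linear).
have combE w : combL w = \sum_i w 0 i *: X`_i by [].
apply: isomorphic_algebras_sym; exists combL.
  exists (fun x => \row_i coord X i x) => [v | x].
    apply/rowP=> i; rewrite mxE /= /comb linear_sum (bigD1 i) //= linearZ /=.
    rewrite coord_free // eqxx mulr1 big1 ?addr0 // => j /negPf ij.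
    by rewrite linearZ /= coord_free // ij mulr0.
  rewrite /= /comb [RHS](coord_basis X_basis (memvf x)).
  by apply: eq_bigr => i _; rewrite mxE.
move=> u v.
rewrite -[LHS]/(combL (\sum_i \sum_j (u 0 i * v 0 j) *: t i j)).
rewrite linear_sum [combL u]combE linear_sumlz.
apply: eq_bigr => i _; rewrite linearZl_LR linear_sum.
rewrite [combL v]combE linear_sumr scaler_sumr.
by apply: eq_bigr => j _; rewrite linearZr_LR scalerA linearZ XX.
Qed.

End LowerCentral.

(** * Centres of the four algebras, and their pairwise non-isomorphism *)

Section Centre.
Variable K : fieldType.
Local Notation a := (delta_mx 0 0 : 'rV[K]_3).
Local Notation b := (delta_mx 0 1 : 'rV[K]_3).
Local Notation c := (delta_mx 0 2%:R : 'rV[K]_3).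

Lemma rV3E (x : 'rV[K]_3) : x = x 0 0 *: a + x 0 1 *: b + x 0 2%:R *: c.
Proof. by rewrite [LHS]row_sum_delta sum_ord3. Qed.

Lemma scale_delta_eq0 n (i : 'I_n) (k : K) :
  (k *: delta_mx 0 i : 'rV[K]_n) = 0 -> k = 0.
Proof. by move/rowP/(_ i); rewrite !mxE !eqxx mulr1. Qed.

(** The vector [c] is central and occurs in no product, so its line splits off. *)
Lemma J32_central_component : has_central_component (J32 K).
Proof.
have bI : b \in (<[a]> + <[b]>)%VS.
  by exact: subvP (addvSr _ _) _ (memv_line _).
exists (<[a]> + <[b]>)%VS, <[c]>%VS; split; split.
- by move=> x y _; rewrite !J32E; split; apply: memvZ.
- move=> _ y /vlineP[k ->].
  by rewrite !J32E !mxE /= !(mulr0, mul0r) scale0r mem0v.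
- apply/eqP; rewrite eqEsubv subvf; apply/subvP=> x _.
  by rewrite [x]rV3E !memv_add ?memvZ ?memv_line.
- apply/eqP; rewrite -subv0; apply/subvP=> x; rewrite memv_cap => /andP[].
  case/memv_addP=> _ /vlineP[k ->] [_ /vlineP[l ->] ->] /vlineP[m def_x].
  have /rowP/(_ 2%:R) := def_x; rewrite !mxE /= !mulr0 mulr1 addr0 => m0.
  by rewrite def_x -m0 scale0r mem0v.
- move=> c0; have : c \in <[c]>%VS by exact: memv_line.
  rewrite c0 memv0 => /eqP/rowP/(_ 2%:R).
  by rewrite !mxE => /eqP; rewrite oner_eq0.
- by move=> _ /vlineP[k ->] y; rewrite J32E !mxE /= !(mulr0, mul0r) scale0r.
Qed.

(** Multiplying a central [z] by [a] and [b] kills its first two coordinates, so [z] is a multiple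
    of [c], the square of [a]. *)
Lemma J33_central_products : central_products (J33 K).
Proof.
move=> z zC; have := zC b; have := zC a; rewrite !J33E !mxE /=.
rewrite !(mulr0, mulr1, add0r, addr0).
move=> /scale_delta_eq0 z0 /scale_delta_eq0 z1.
exists (z 0 2%:R *: a), a; rewrite [LHS]rV3E J33E !mxE /=.
by rewrite z0 z1 !(scale0r, add0r, mulr0, mulr1, addr0).
Qed.

(** Again a central [z] is a multiple of [c], which here is the product of [a] and [b]. *)
Lemma J34_central_products : central_products (J34 K).
Proof.
move=> z zC; have := zC b; have := zC a; rewrite !J34E !mxE /=.
rewrite !(mulr0, mulr1, add0r, scale0r) => za /scale_delta_eq0.
rewrite addr0 => z0; move: za; rewrite z0 scale0r add0r => /scale_delta_eq0 z1.
exists (z 0 2%:R *: a), b; rewrite [LHS]rV3E J34E !mxE /=.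
by rewrite z0 z1 !(scale0r, add0r, mulr0, mulr1, addr0).
Qed.

Lemma J3_zero k : zero_algebra (J3 K k) <-> (k < 1)%N.
Proof.
apply: (J3_ind (P := fun k A => zero_algebra A <-> (k < 1)%N)); split=> // zA.
- by move=> x y; rewrite J31E.
- have /rowP/(_ 1) := zA a a; rewrite J32E !mxE /= !mulr1.
  by move/eqP; rewrite oner_eq0.
- have /rowP/(_ 2%:R) := zA a a; rewrite J33E !mxE /= !(mulr1, mulr0, addr0).
  by move/eqP; rewrite oner_eq0.
- have /rowP/(_ 1) := zA a a; rewrite J34E !mxE /= !(mulr1, mulr0, addr0).
  by move/eqP; rewrite oner_eq0.
Qed.

Lemma J3_two_step k : two_step (J3 K k) <-> (k < 3)%N.
Proof.
apply: (J3_ind (P := fun k A => two_step A <-> (k < 3)%N)); split=> // mul3.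
- by move=> x y z; rewrite !J31E.
- by move=> x y z; rewrite !J32E !mxE /= !(mulr0, mul0r) scale0r.
- by move=> x y z; rewrite !J33E !mxE /= !(mulr0, mul0r) addr0 scale0r.
- have /rowP/(_ 2%:R) := mul3 a a a; rewrite !J34E !mxE /=.
  rewrite !(mulr1, mulr0, addr0, mul0r, add0r).
  by move/eqP; rewrite oner_eq0.
Qed.

Lemma not_central_products (A : {bilinear 'rV[K]_3 -> 'rV[K]_3 -> 'rV[K]_3}) :
  in_centre A c -> (forall x y, A x y 0 2%:R = 0) -> ~ central_products A.
Proof.
move=> cC A2 cP; have [x [y /rowP/(_ 2%:R)]] := cP _ cC.
by rewrite A2 !mxE /= => /eqP; rewrite oner_eq0.
Qed.

Lemma J3_central_products k : central_products (J3 K k) <-> (1 < k)%N.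
Proof.
apply: (J3_ind (P := fun k A => central_products A <-> (1 < k)%N)); split=> //.
- move=> cP; case: (not_central_products _ _ cP) => [y | x y]; rewrite J31E.
  + by [].
  + by rewrite mxE.
- move=> cP; case: (not_central_products _ _ cP) => [y | x y];
    rewrite J32E !mxE /=.
  + by rewrite mul0r scale0r.
  + by rewrite mulr0.
- by move=> _; apply: J33_central_products.
- by move=> _; apply: J34_central_products.
Qed.

Lemma J3_iso_inj k l : isomorphic_algebras (J3 K k) (J3 K l) -> k = l.
Proof.
move=> kl; have lk := isomorphic_algebras_sym kl.
have invariant P (d : pred nat) : isomorphism_invariant P ->
  (forall m, P _ (J3 K m) <-> d m) -> d k = d l.
  move=> P_iso P_d; apply/idP/idP=> /P_d.
    by move/(P_iso _ _ _ _ kl)/P_d.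
  by move/(P_iso _ _ _ _ lk)/P_d.
have := invariant _ (fun m => m < 1)%N (@zero_algebra_iso K) J3_zero.
have := invariant _ (fun m => 1 < m)%N (@central_products_iso K)
  J3_central_products.
have := invariant _ (fun m => m < 3)%N (@two_step_iso K) J3_two_step.
(* The truth values of [k < 1], [1 < k] and [k < 3] together determine [k] among 0, 1, 2, 3. *)
move=> {kl lk invariant} lt3 gt1 lt1; apply: val_inj; move: lt3 gt1 lt1.
by case: k => [[|[|[|[|]]]] ?]; case: l => [[|[|[|[|]]]] ?].
Qed.

End Centre.

(** * Classification in dimension 3 *)

Section Classification.
Variables (K : closedFieldType) (J : vectType K) (mul : {bilinear J -> J -> J}).
Hypotheses (charK : 2%N \notin [pchar K]) (dimJ : \dim {: J} = 3%N).
Hypotheses (J_jordan : jordan_algebra mul) (J_nil : nilpotent_algebra mul).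
Local Notation "x ** y" := (mul x y) (at level 40).
Local Notation c := (lower_central mul).

Lemma mulC x y : x ** y = y ** x. Proof. by have [->] := J_jordan. Qed.

Lemma basis3 (x y z : J) :
  x \notin <<[:: y; z]>>%VS -> y \notin <[z]>%VS -> z != 0 ->
  basis_of fullv [tuple x; y; z].
Proof.
move=> x_yz y_z z_neq0.
rewrite basisEfree !free_cons span_seq1 nil_free span_nil memv0.
by rewrite x_yz y_z z_neq0 subvf dimJ.
Qed.

(** Algebraic closedness enters here, through the equation [X^2 = r + 0 X]. *)
Lemma sqrt_exists (r : K) : exists s, s ^+ 2 = r.
Proof.
have [s] := @solve_monicpoly K 2 (fun i => if i is 0%N then r else 0) isT.
by rewrite !big_ord_recl big_ord0 /= mulr1 mul0r !addr0 => <-; exists s.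
Qed.

(** If [x] and [y] both square to zero, the square of [x + y] is twice [x ** y]. *)
Lemma exists_square_neq0 x y : x ** y != 0 -> exists z, z ** z != 0.
Proof.
move=> xy_neq0; have [xx0|] := eqVneq (x ** x) 0; last by exists x.
have [yy0|] := eqVneq (y ** y) 0; last by exists y.
exists (x + y); rewrite linearDl !linearDr /= xx0 yy0 add0r addr0 (mulC y x).
rewrite -mulr2n -scaler_nat scaler_eq0 negb_or xy_neq0 andbT.
by apply: contraNneq charK => K2; rewrite inE /= K2 eqxx.
Qed.

Lemma c2_le2 : (\dim (c 2) <= 2)%N.
Proof.
have c1_neq0 : c 1 != 0%VS by rewrite -dimv_eq0 dimJ.
have := lower_central_strict J_nil c1_neq0.
by rewrite {2}/lower_central /= dimJ.
Qed.

Lemma iso_J34 : \dim (c 2) = 2%N -> isomorphic_algebras mul (J34 K).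
Proof.
move=> c2_dim.
have c2_neq0 : c 2 != 0%VS by rewrite -dimv_eq0 c2_dim.
have c3_dim : (\dim (c 3) <= 1)%N.
  by have := lower_central_strict J_nil c2_neq0; rewrite c2_dim.
have c4_0 : c 4 = 0%VS.
  apply/eqP; have [c3_0|c3_neq0] := eqVneq (c 3) 0%VS.
    by rewrite -subv0 -c3_0 lower_central_sub.
  rewrite -dimv_eq0 -leqn0 -ltnS.
  exact: leq_trans (lower_central_strict J_nil c3_neq0) c3_dim.
have c3J x y : x \in c 3 -> x ** y = 0.
  by move=> c3x; apply/eqP; rewrite -memv0 -c4_0 memv_prodspace ?memvf.
have [a _ a_c2] : exists2 a, a \in fullv & a \notin c 2.
  by apply/subvPn; apply/negP => /dimvS; rewrite dimJ c2_dim.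
have full_a : (<[a]> + c 2)%VS = fullv.
  apply/eqP; rewrite eqEdim subvf dimJ dimv_disjoint_sum ?c2_dim.
    by rewrite dim_vline eq_sym (memPn a_c2 0 (mem0v _)).
  apply/eqP; rewrite -subv0; apply/subvP=> x; rewrite memv_cap => /andP[].
  case/vlineP=> k -> c2ka; have [->|k_neq0] := eqVneq k 0.
    by rewrite scale0r mem0v.
  by case/negP: a_c2; rewrite -[a](scalerK k_neq0) memvZ.
have aaC2 : a ** a \in c 2 by rewrite memv_prodspace ?memvf.
have a_c2_dec x : exists k, exists2 u, u \in c 2 & x = k *: a + u.
  have /memv_addP[y /vlineP[k ->] [u c2u ->]] : x \in (<[a]> + c 2)%VS.
    by rewrite full_a memvf.
  by exists k, u.
(* Modulo [c 3], only the multiples of [a] in the two factors contribute to a product. *)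
have c2_sub : (c 2 <= <[a ** a]> + c 3)%VS.
  apply/prodspaceP=> x y _ _.
  have [k [u c2u ->]] := a_c2_dec x; have [l [v c2v ->]] := a_c2_dec y.
  rewrite linearDl linearDr /= linearZl_LR linearZr_LR scalerA -addrA.
  rewrite memv_add ?memvZ ?memv_line //.
  by apply: memvD; [rewrite mulC|]; rewrite memv_prodspace ?memvf.
(* The Jordan identity at [x = y = a] moves this product into [c 4]. *)
have a4 : (a ** a) ** (a ** a) = 0.
  have [_ ->] := J_jordan; rewrite mulC c3J //.
  by rewrite !memv_prodspace ?memvf.
have aaa_c3 : (a ** a) ** a \in c 3 by rewrite !memv_prodspace ?memvf.
(* Otherwise [a ** a] would annihilate both [a] and [c 2], hence everything; then [c 3 = 0] and
   [c 2] would be at most a line. *)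
have aaa_neq0 : (a ** a) ** a != 0.
  apply: contra_eq_neq c2_dim => aaa0.
  suffices c3_0 : c 3 = 0%VS.
    rewrite neq_ltn; apply/orP; left; rewrite ltnS.
    by apply: leq_trans (dimvS c2_sub) _; rewrite c3_0 addv0 dim_vline leq_b1.
  apply/eqP; rewrite -subv0; apply/prodspaceP=> u v c2u _; rewrite memv0.
  have /memv_addP[_ /vlineP[k ->] [s c3s ->]] := subvP c2_sub u c2u.
  have [l [w c2w ->]] := a_c2_dec v.
  have /memv_addP[_ /vlineP[m ->] [t c3t ->]] := subvP c2_sub w c2w.
  rewrite linearDl /= [X in _ + X]c3J // addr0 linearZl_LR.
  rewrite !linearDr /= !linearZr_LR /=.
  by rewrite aaa0 a4 (mulC _ t) c3J // !(scaler0, addr0).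
pose X := [tuple a; a ** a; (a ** a) ** a].
apply: (isomorphic_table (X := X)).
  apply: basis3 => //; last first.
    (* If [a ** a] were a multiple of its product with [a], it would lie in [c 3] and annihilate
       [a]. *)
    apply: contra aaa_neq0 => /vlineP[k aa]; rewrite {1}aa linearZl_LR.
    by rewrite c3J ?scaler0.
  apply: contra a_c2; apply: subvP; apply/span_subvP=> x.
  rewrite !inE => /orP[] /eqP -> //.
  by apply: subvP aaa_c3; apply: lower_central_sub.
have aaaJ u : ((a ** a) ** a) ** u = 0 by apply: c3J.
have Jaaa u : u ** ((a ** a) ** a) = 0 by rewrite mulC.
by do 2![apply: forall_ord3]; rewrite sum_ord3 !mxE /=
  !(scale0r, scale1r, add0r, addr0) ?(a4, aaaJ, Jaaa) // mulC.
Qed.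

Lemma iso_J31_J32_J33 : (\dim (c 2) <= 1)%N ->
  [\/ isomorphic_algebras mul (J31 K), isomorphic_algebras mul (J32 K)
    | isomorphic_algebras mul (J33 K)].
Proof.
move=> c2_dim.
have c3_0 : c 3 = 0%VS.
  apply/eqP; have [c2_0|c2_neq0] := eqVneq (c 2) 0%VS.
    by rewrite -subv0 -c2_0 lower_central_sub.
  rewrite -dimv_eq0 -leqn0 -ltnS.
  exact: leq_trans (lower_central_strict J_nil c2_neq0) c2_dim.
have mul3 x y z : (x ** y) ** z = 0.
  by apply/eqP; rewrite -memv0 -c3_0 !memv_prodspace ?memvf.
have [c2_0|c2_neq0] := eqVneq (c 2) 0%VS.
  (* With all products zero any basis fits; the cast only turns its length into 3. *)
  apply: Or31; apply: (isomorphic_table (X := tcast dimJ (vbasis fullv))).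
    by rewrite /basis_of val_tcast; apply: vbasisP.
  move=> i j; rewrite big1 => [|k _]; last by rewrite mxE scale0r.
  by apply/eqP; rewrite -memv0 -c2_0 memv_prodspace ?memvf.
have [x [y [_ _ /exists_square_neq0[a aa_neq0]]]] := prodspace_neq0 c2_neq0.
have c2E : c 2 = <[a ** a]>%VS.
  apply/eqP; rewrite eq_sym eqEdim dim_vline aa_neq0 c2_dim andbT.
  by rewrite -memvE memv_prodspace ?memvf.
have aa_mul u : (a ** a) ** u = 0 by [].
have mul_aa u : u ** (a ** a) = 0 by rewrite mulC.
pose L := linfun (mul a).
(* The image of [L] lies in [c 2], so its kernel has dimension at least 2 and is not contained in a
   line. *)
have [b] : exists2 b, b \in lker L & b \notin <[a ** a]>%VS.
  apply/subvPn/negP => /dimvS; rewrite dim_vline aa_neq0 => kerL.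
  have imL : (\dim (limg L) <= 1)%N.
    apply: leq_trans c2_dim; apply: dimvS; apply/subvP=> _ /memv_imgP[u _ ->].
    by rewrite lfunE memv_prodspace ?memvf.
  have := limg_ker_dim L fullv; rewrite capfv dimJ => dimE.
  by have := leq_add kerL imL; rewrite dimE.
rewrite memv_ker lfunE /= => /eqP ab0 b_aa.
have ba0 : b ** a = 0 by rewrite mulC.
have [r bb] : exists r, b ** b = r *: (a ** a).
  by apply/vlineP; rewrite -c2E memv_prodspace ?memvf.
(* A vector [a] in the span of [b'] and [a ** a] would be killed by [L], against [a ** a != 0]. *)
have basis_ab (b' : J) : a ** b' = 0 -> b' \notin <[a ** a]>%VS ->
  basis_of fullv [tuple a; b'; a ** a].
  move=> ab'0 b'_aa; apply: basis3 => //; apply: contra aa_neq0 => a_span.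
  suffices: a \in lker L by rewrite memv_ker lfunE.
  apply: subvP a_span; apply/span_subvP=> u; rewrite !inE memv_ker lfunE /=.
  by case/orP=> /eqP ->; rewrite ?ab'0 ?mul_aa.
have [r0 | r_neq0] := eqVneq r 0.
  apply: Or32; apply: (isomorphic_table (X := [tuple a; a ** a; b])).
    (* The table of [J32] wants the square in second place, hence the permuted basis. *)
    apply: etrans (basis_ab b ab0 b_aa); apply: perm_basis.
    by rewrite perm_cons (perm_catC [:: a ** a] [:: b]).
  by do 2![apply: forall_ord3]; rewrite sum_ord3 !mxE /=
    ?bb ?r0 ?(ab0, ba0, aa_mul, mul_aa) !(scale0r, scale1r, add0r, addr0).
have [s s2] := sqrt_exists r.
have s_neq0 : s != 0 by apply: contraNneq r_neq0 => s0; rewrite -s2 s0 expr0n.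
(* Dividing by a square root of [r] makes the square of [b'] equal to that of [a]. *)
pose b' := s^-1 *: b.
have ab'0 : a ** b' = 0 by rewrite linearZr_LR ab0 scaler0.
have b'a0 : b' ** a = 0 by rewrite mulC.
have b'b' : b' ** b' = a ** a.
  rewrite linearZl_LR linearZr_LR /= bb !scalerA -s2.
  by rewrite (_ : _ * _ = 1) ?scale1r //; field.
apply: Or33; apply: (isomorphic_table (X := [tuple a; b'; a ** a])).
  apply: basis_ab => //.
  by apply: contra b_aa => /(memvZ s); rewrite scalerA mulfV // scale1r.
by do 2![apply: forall_ord3]; rewrite sum_ord3 !mxE /=
  ?(b'b', ab'0, b'a0, aa_mul, mul_aa) !(scale0r, scale1r, add0r, addr0).
Qed.

End Classification.

Theorem theorem33 (K : closedFieldType) (charK : 2%N \notin [pchar K]) :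
  [/\ (forall k : 'I_4,
         [/\ \dim {: 'rV[K]_3} = 3%N, jordan_algebra (J3 K k)
           & nilpotent_algebra (J3 K k)]),
      [/\ has_central_component (J31 K),
          has_central_component (J32 K),
          ~ has_central_component (J33 K)
        & ~ has_central_component (J34 K)],
      (forall k l : 'I_4,
         isomorphic_algebras (J3 K k) (J3 K l) -> k = l)
    & (forall (J : vectType K) (mul : {bilinear J -> J -> J}),
         \dim {: J} = 3%N -> jordan_algebra mul -> nilpotent_algebra mul ->
         exists k : 'I_4, isomorphic_algebras mul (J3 K k))].
Proof.
split.
- move=> k; split; [by rewrite dimvf | exact: J3_jordan |].
  exact/mul4_nilpotent/J3_mul4.
- split.
  (* The zero algebra is its own centre, so the whole space serves as central summand. *)
  + exists 0%VS, fullv; split; [split | split].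
    * by move=> x y; rewrite !memv0 => /eqP ->; rewrite linear0l linear0r.
    * by move=> x y _; rewrite !memvf.
    * by rewrite add0v.
    * by rewrite cap0v.
    * by apply/eqP; rewrite -dimv_eq0 dimvf.
    * by move=> x _ y; rewrite J31E.
  + exact: J32_central_component.
  + exact/no_central_component/J33_central_products.
  + exact/no_central_component/J34_central_products.
- exact: J3_iso_inj.
- move=> J mul dimJ mul_jordan mul_nil.
  have := c2_le2 dimJ mul_nil; rewrite leq_eqVlt ltnS => /orP[/eqP | ] dim_c2.
    by exists 3%:R; apply: iso_J34.
  have [iso|iso|iso] := iso_J31_J32_J33 charK dimJ mul_jordan mul_nil dim_c2.
  + by exists 0.
  + by exists 1.
  + by exists 2%:R.
Qed.
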